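(* Fix $\alpha,\beta\in\mathbb{R}$ with $\beta\neq 0$ and $(\alpha-1)^2+\beta^2\neq 1$, and for $m>0$ let $(G,g_m)$ be the simply connected Lie group with left invariant metric described in the context (a $(\lambda,4+m)$-Einstein metric). As $m\to\infty$, the metrics $(G,g_m)$ converge in $C^{\infty}$ to a Riemannian product $(\mathbb{R}\times H,\ \mathrm{d}t^{2}+g_{0})$, where $(H,g_{0})$ is a three dimensional solvsoliton.
   Context: The metrics $g_m$. Put $\lambda=-2(2-2\alpha+\alpha^2+\beta^2)$ and let $z=z_m$ be the negative number with $z^2=\frac{-4}{\lambda(m+2)+4}$ (the choice of sign is immaterial up to isometry, since $z\mapsto -z$ corresponds to $X_0\mapsto -X_0$). Then $(G,g_m)$ is the simply connected Lie group whose Lie algebra has a basis $X_0,X_1,X_2,X_3$, orthonormal for the left invariant metric $g_m$, with the only possibly nonzero brackets (up to antisymmetry) $$[X_1,X_2]=\alpha X_2+\beta X_3,\qquad [X_1,X_3]=\beta X_2+(2-\alpha)X_3,$$ $$[X_0,X_2]=F_{22}X_2+F_{23}X_3,\qquad [X_0,X_3]=F_{32}X_2+F_{33}X_3,$$ where $F_{23}=F_{32}=\beta z$, $F_{22}=-(2-3\alpha+\alpha^2+\beta^2)z$ and $F_{33}=-(-\alpha+\alpha^2+\beta^2)z$. $C^\infty$ convergence of such left invariant metrics, with respect to the orthonormal frames $X_0,\dots,X_3$, is equivalent to convergence of the structure constants $C_{ijk}=g([X_i,X_j],X_k)$ to those of an orthonormal left invariant frame of the limit metric, and may be understood in this sense.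 A $(\lambda,n+m)$-Einstein manifold $(M^n,g,w)$ is a complete Riemannian manifold, possibly with boundary, with a smooth function $w$ satisfying $\mathrm{Hess}\,w=\frac{w}{m}(\mathrm{Ric}-\lambda g)$, $w>0$ on $\mathrm{int}(M)$, $w=0$ on $\partial M$ (and $\Delta w=-\lambda w$ if $m=1$). A left invariant metric on a simply connected solvable Lie group with Lie algebra $\mathfrak{h}$ is a solvsoliton if its Ricci tensor, as an endomorphism of $\mathfrak{h}$, satisfies $\mathrm{Ric}=cI+D$ with $c$ a constant and $D$ a derivation of $\mathfrak{h}$. *)

(* Defs.v *)
From HB Require Import structures.
From mathcomp Require Import all_boot all_order all_algebra.
From mathcomp Require Import sesquilinear.
From mathcomp Require Import all_classical all_reals all_analysis.

Set Implicit Arguments.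
Unset Strict Implicit.
Unset Printing Implicit Defensive.

Import Order.TTheory GRing.Theory Num.Theory.
Import numFieldNormedType.Exports.

Local Open Scope classical_set_scope.
Local Open Scope ring_scope.

(* A simply connected Lie group with a left invariant metric is represented by
   its Lie algebra with the induced inner product: Lie's third theorem makes
   this a one-to-one correspondence up to isomorphism, and all the tensors
   below are left invariant. *)

Record lieAlgebra (R : realType) := LieAlgebra {
  lieCarrier :> vectType R;
  lie : {bilinear lieCarrier -> lieCarrier -> lieCarrier};
  liexx : forall x, lie x x = 0;
  jacobi : forall x y z,
    lie x (lie y z) + lie y (lie z x) + lie z (lie x y) = 0 }.

Record metricLieAlgebra (R : realType) := MetricLieAlgebra {
  metricCarrier :> lieAlgebra R;
  ip : {dot metricCarrier for idfun} }.

Arguments lie {R l} : rename.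
Arguments ip {R m} : rename.

Section LieAlgebraNotions.
Variables (R : realType) (g : lieAlgebra R).

(* [U, U], the span of all brackets of elements of U *)
Definition derived (U : {vspace g}) : {vspace g} :=
  <<[seq lie x y | x <- vbasis U, y <- vbasis U]>>%VS.

Definition lie_solvable : Prop := exists k, iter k derived fullv = 0%VS.

Definition derivation (D : 'End(g)) : Prop :=
  forall x y, D (lie x y) = lie (D x) y + lie x (D y).

End LieAlgebraNotions.

(* Only meaningful for linear f; the basis chosen is then immaterial. *)
Definition endo_trace (R : realType) (V : vectType R) (f : V -> V) : R :=
  \sum_(i < \dim {:V}) coord (vbasis {:V}) i (f (vbasis {:V})`_i).

Section MetricNotions.
Variables (R : realType) (g : metricLieAlgebra R).
Implicit Types (x y w : g) (nabla : {bilinear g -> g -> g}).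

Definition orthonormal_basis n (X : n.-tuple g) : Prop :=
  basis_of fullv X /\ forall i j : 'I_n, ip X`_i X`_j = (i == j)%:R.

(* C_ijk = g([X_i, X_j], X_k) *)
Definition struct_const n (X : n.-tuple g) (i j k : 'I_n) : R :=
  ip (lie X`_i X`_j) X`_k.

(* The Levi-Civita connection restricted to left invariant fields: it is torsion
   free, and since the product of two left invariant fields is constant,
   compatibility with the metric says that each nabla x is skew. *)
Definition levi_civita nabla : Prop :=
  (forall x y, nabla x y - nabla y x = lie x y) /\
  (forall x y w, ip (nabla x y) w + ip y (nabla x w) = 0).

Definition curvature nabla x y w : g :=
  nabla x (nabla y w) - nabla y (nabla x w) - nabla (lie x y) w.

Definition ricci_form nabla x y : R :=
  endo_trace (fun w => curvature nabla w x y).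

Definition is_ricci nabla (Ric : 'End(g)) : Prop :=
  forall x y, ip (Ric x) y = ricci_form nabla x y.

Definition solvsoliton : Prop :=
  lie_solvable g /\
  exists (nabla : {bilinear g -> g -> g}) (Ric : 'End(g)) (c : R) (D : 'End(g)),
    [/\ levi_civita nabla, is_ricci nabla Ric, derivation D
      & Ric = c *: \1%VF + D].

End MetricNotions.

Section LineProduct.
Variables (R : realType) (h : metricLieAlgebra R).

Definition line_lie (u v : R^o * h) : R^o * h := (0, lie u.2 v.2).
Definition line_ip (u v : R^o * h) : R := (u.1 : R) * v.1 + ip u.2 v.2.

Lemma line_lie_bilinear : bilinear_for *:%R *:%R line_lie.
Proof.
split=> [u'|u] a x y; rewrite /line_lie /=.
  by rewrite linearPl; congr pair; rewrite /= scaler0 addr0.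
by rewrite linearPr; congr pair; rewrite /= scaler0 addr0.
Qed.

HB.instance Definition _ :=
  bilinear_isBilinear.Build R (R^o * h)%type (R^o * h)%type (R^o * h)%type
    *:%R *:%R line_lie line_lie_bilinear.

Lemma line_liexx u : line_lie u u = 0.
Proof. by rewrite /line_lie liexx. Qed.

Lemma line_jacobi u v w :
  line_lie u (line_lie v w) + line_lie v (line_lie w u)
    + line_lie w (line_lie u v) = 0.
Proof.
rewrite /line_lie /=; congr pair; last exact: jacobi.
by rewrite /= !addr0.
Qed.

Definition line_lieAlgebra : lieAlgebra R :=
  LieAlgebra line_liexx line_jacobi.

Lemma line_ip_bilinear :
  bilinear_for (U := line_lieAlgebra) (U' := line_lieAlgebra)
    *%R (idfun \; *%R) line_ip.
Proof.
have ipP (s t s1 t1 b : R) : (b * s + t) * s1 + (b * t1) = b * (s * s1 + t1) + t * s1.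
  by rewrite mulrDl mulrDr mulrA addrAC.
split=> [[s' y']|[s y]] a [s1 y1] [s2 y2]; rewrite /line_ip /=.
  rewrite [ip _ _]linearPl /=; change ((a * s1 + s2) * s' + (a * ip y1 y' + ip y2 y')
    = a * (s1 * s' + ip y1 y') + (s2 * s' + ip y2 y')).
  by rewrite addrA ipP addrA.
rewrite [ip _ _]linearPr /=; change (s * (a * s1 + s2) + (a * ip y y1 + ip y y2)
  = a * (s * s1 + ip y y1) + (s * s2 + ip y y2)).
by rewrite addrA mulrC ipP [s1 * _]mulrC [s2 * _]mulrC addrA.
Qed.

Lemma line_ip_sym (u v : line_lieAlgebra) :
  line_ip u v = (-1) ^+ false * idfun (line_ip v u).
Proof.
rewrite expr0 mul1r /line_ip /= [u.1 * _]mulrC; congr (_ + _).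
by rewrite (@hermitian_subproof _ _ _ _ ip) expr0 mul1r.
Qed.

Lemma line_ip_gt0 (u : line_lieAlgebra) : u != 0 -> 0 < line_ip u u.
Proof.
case: u => s y /=; rewrite /line_ip /=.
have [-> u0|y0 _] := eqVneq y 0.
  rewrite linear0r addr0 -expr2 exprn_even_gt0 //=.
  by apply: contraNneq u0 => ->.
by rewrite ltr_wpDl -?expr2 ?sqr_ge0 // neq0_dnorm_gt0.
Qed.

HB.instance Definition _ :=
  bilinear_isBilinear.Build R line_lieAlgebra line_lieAlgebra R
    *%R (idfun \; *%R) line_ip line_ip_bilinear.
HB.instance Definition _ :=
  isHermitianSesquilinear.Build R line_lieAlgebra false idfun line_ip line_ip_sym.
HB.instance Definition _ :=
  isDotProduct.Build R line_lieAlgebra line_ip line_ip_gt0.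

(* the Riemannian product (R x H, dt^2 + g_0) *)
Definition line_product : metricLieAlgebra R :=
  @MetricLieAlgebra R line_lieAlgebra line_ip.

End LineProduct.

(* Smooth convergence of (G m, X m) to L as m -> +oo with respect to the
   orthonormal left invariant frames X m. *)
Definition smooth_cvg (R : realType) n (G : R -> metricLieAlgebra R)
    (X : forall m, n.-tuple (G m)) (L : metricLieAlgebra R) : Prop :=
  exists Y : n.-tuple L, orthonormal_basis Y /\
    forall i j k : 'I_n,
      struct_const (X m) i j k @[m --> +oo] --> struct_const Y i j k.

Definition einstein_const (R : realType) (alpha beta : R) : R :=
  - 2 * (2 - 2 * alpha + alpha ^+ 2 + beta ^+ 2).

(* X = (X_0, .., X_3) is the distinguished frame of the metric Lie algebra with
   parameters alpha, beta and z = z_m. *)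
Definition gm_frame (R : realType) (alpha beta z : R) (g : metricLieAlgebra R)
    (X : 4.-tuple g) : Prop :=
  let F22 := - (2 - 3 * alpha + alpha ^+ 2 + beta ^+ 2) * z in
  let F33 := - (- alpha + alpha ^+ 2 + beta ^+ 2) * z in
  let F23 := beta * z in
  let F32 := beta * z in
  orthonormal_basis X /\
  [/\ lie X`_0 X`_1 = 0, lie X`_2 X`_3 = 0,
      lie X`_1 X`_2 = alpha *: X`_2 + beta *: X`_3 /\
      lie X`_1 X`_3 = beta *: X`_2 + (2 - alpha) *: X`_3,
      lie X`_0 X`_2 = F22 *: X`_2 + F23 *: X`_3
    & lie X`_0 X`_3 = F32 *: X`_2 + F33 *: X`_3].

(* Main.v *)
(* As m -> oo we have z_m^2 <= 2/m, hence z_m -> 0, and the structure constants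
   are affine in z_m. Setting z = 0 leaves X_0 central and not a bracket, and
   X_1 acting on the abelian ideal <X_2, X_3> by the symmetric matrix
   A = [[alpha, beta], [beta, 2 - alpha]], so the limit is R x (R |x_A R^2).

   For any symmetric n x n matrix A, the metric Lie algebra R |x_A R^n has Ricci
   operator -tr(A^2) on R and -tr(A) A on R^n. Hence Ric = -tr(A^2) I + D, where
   D kills R and is tr(A^2) I - tr(A) A on R^n; the latter commutes with A, so D
   is a derivation. *)

From HB Require Import structures.
Require Import Defs.
From mathcomp Require Import all_boot all_order all_algebra.
From mathcomp Require Import sesquilinear ring lra.
From mathcomp Require Import all_classical all_reals all_analysis.

Import Order.TTheory GRing.Theory Num.Theory.
Import numFieldNormedType.Exports.

Local Open Scope classical_set_scope.
Local Open Scope ring_scope.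

Lemma sub_derived (R : realType) (g : lieAlgebra R) (U W : {vspace g}) :
  {in U &, forall x y, lie x y \in W} -> (derived U <= W)%VS.
Proof.
move=> lieUW; apply/span_subvP => _ /allpairsP[[x y] /= [Ux Uy ->]].
by apply: lieUW; apply: vbasis_mem.
Qed.

(** * Dot product of row vectors *)

Section RowDot.
Variables (R : realType) (n : nat).
Implicit Types (u v w : 'rV[R]_n) (B : 'M[R]_n).

(** Written as the trace of a 1 x 1 matrix, so that symmetry and the adjoint rule [rdot_sym] follow
    from transposition. *)
Definition rdot v w : R := \tr (v *m w^T).

Lemma rdotC v w : rdot v w = rdot w v.
Proof. by rewrite /rdot -mxtrace_tr trmx_mul trmxK. Qed.

Lemma rdotE v w : rdot v w = \sum_i v 0 i * w 0 i.
Proof. by rewrite /rdot trace_mx11 mxE; apply: eq_bigr => i _; rewrite !mxE. Qed.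

Lemma rdotPl w a u v : rdot (a *: u + v) w = a * rdot u w + rdot v w.
Proof. by rewrite /rdot mulmxDl -scalemxAl mxtraceD mxtraceZ. Qed.

Lemma rdotPr w a u v : rdot w (a *: u + v) = a * rdot w u + rdot w v.
Proof. by rewrite !(rdotC w) rdotPl. Qed.

Lemma rdot0l w : rdot 0 w = 0.
Proof. by rewrite /rdot mul0mx mxtrace0. Qed.

Lemma rdotZl w a u : rdot (a *: u) w = a * rdot u w.
Proof. by rewrite -[a *: u]addr0 rdotPl rdot0l addr0. Qed.

Lemma rdotDl w u v : rdot (u + v) w = rdot u w + rdot v w.
Proof. by rewrite -[u]scale1r rdotPl mul1r scale1r. Qed.

Lemma rdotZr w a u : rdot w (a *: u) = a * rdot w u.
Proof. by rewrite !(rdotC w) rdotZl. Qed.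

Lemma rdotNl w u : rdot (- u) w = - rdot u w.
Proof. by rewrite -scaleN1r rdotZl mulN1r. Qed.

Lemma rdotNr w u : rdot w (- u) = - rdot w u.
Proof. by rewrite !(rdotC w) rdotNl. Qed.

Lemma rdot_sym B v w : B^T = B -> rdot (v *m B) w = rdot v (w *m B).
Proof. by move=> symB; rewrite /rdot trmx_mul symB mulmxA. Qed.

Lemma rdot_ge0 v : 0 <= rdot v v.
Proof. by rewrite rdotE sumr_ge0 // => i _; rewrite -expr2 sqr_ge0. Qed.

Lemma rdot_gt0 v : v != 0 -> 0 < rdot v v.
Proof.
apply: contraNT; rewrite -leNgt => v_le0; apply/eqP/rowP => i; rewrite mxE.
have /eqP : rdot v v = 0 by apply/le_anti; rewrite v_le0 rdot_ge0.
rewrite rdotE psumr_eq0 => [/allP /(_ i)|j _]; last by rewrite -expr2 sqr_ge0.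
by rewrite mem_index_enum mulf_eq0 orbb => /(_ isT) /eqP.
Qed.

Lemma rdot_delta v j : rdot v (delta_mx 0 j) = v 0 j.
Proof.
rewrite rdotE (bigD1 j) //= mxE !eqxx mulr1 big1 ?addr0 //.
by move=> k /negPf jk; rewrite mxE jk andbF mulr0.
Qed.

Lemma sum_delta_mul_mx B : \sum_i (delta_mx 0 i *m B : 'rV_n) 0 i = \tr B.
Proof. by apply: eq_bigr => i _; rewrite -rowE mxE. Qed.

(** The left side is the trace of the rank-one map [u |-> rdot (u *m B) w *: v]; such a map occurs
    in the Ricci trace. *)
Lemma sum_rdot_delta_mul_mx B v w :
  \sum_i rdot (delta_mx 0 i *m B) w * v 0 i = rdot (v *m B) w.
Proof.
rewrite [v in RHS]row_sum_delta /rdot !mulmx_suml raddf_sum.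
by apply: eq_bigr => i _; rewrite -!scalemxAl [RHS]mxtraceZ mulrC.
Qed.

End RowDot.

Arguments rdot {R n}.

(** * Traces in a metric Lie algebra *)

Section MetricTrace.
Variables (R : realType) (g : metricLieAlgebra R).

(** Expand each basis vector along [e] and exchange the sums: the coordinates of [f (e j)] then
    reassemble into [f (e j)]. A general finite index type allows a frame indexed by a disjoint
    sum. *)
Lemma endo_trace_ip (I : finType) (e : I -> g) (f : g -> g) :
    linear f -> (forall x, x = \sum_i ip x (e i) *: e i) ->
  endo_trace f = \sum_i ip (f (e i)) (e i).
Proof.
move=> f_lin eK.
pose fl : {linear g -> g} :=
  HB.pack f (GRing.isLinear.Build R g g *:%R f f_lin).
set b := vbasis {:g}; rewrite /endo_trace -/b.
transitivity (\sum_(i < \dim {:g}) \sum_j ip b`_i (e j) * coord b i (f (e j))).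
  apply: eq_bigr => i _; rewrite {1}[b`_i]eK -[f]/(fl : g -> g) !linear_sum.
  by apply: eq_bigr => j _; rewrite !linearZ.
rewrite exchange_big; apply: eq_bigr => j _.
rewrite [in RHS](coord_vbasis (memvf (f (e j)))) linear_sumlz.
by apply: eq_bigr => i _; rewrite linearZl_LR mulrC.
Qed.

Lemma curvature_linear (nabla : {bilinear g -> g -> g}) x y :
  linear (fun w => curvature nabla w x y).
Proof.
move=> a u v; rewrite /curvature !linearPl !linearPr !scalerBr.
by rewrite !opprD [X in X + _ = _]addrACA [LHS]addrACA.
Qed.

End MetricTrace.

(* The semidirect product of R and the abelian R^n in which (1, 0) acts by the
   row-vector map v |-> v *m A. *)
Section Semidirect.
Variables (R : realType) (n : nat) (A : 'M[R]_n).

Local Notation V := (R^o * 'rV[R]_n)%type.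
Implicit Types x y w : V.

Definition semi_lie x y : V :=
  (0, (x.1 : R) *: (y.2 *m A) - (y.1 : R) *: (x.2 *m A)).

Lemma semi_lie_bilinear : bilinear_for *:%R *:%R semi_lie.
Proof.
split=> [w|w] a x y; rewrite /semi_lie; congr pair; rewrite /= ?scaler0 ?addr0 //.
  rewrite mulmxDl -scalemxAl !scalerBr !scalerDr !scalerDl !scalerA.
  rewrite -[a *: x.1]/(a * x.1) [a * w.1]mulrC opprD.
  by rewrite addrACA.
rewrite mulmxDl -scalemxAl !scalerBr !scalerDr !scalerDl !scalerA.
rewrite -[a *: x.1]/(a * x.1) [a * w.1]mulrC opprD.
by rewrite addrACA.
Qed.

HB.instance Definition _ :=
  bilinear_isBilinear.Build R V V V *:%R *:%R semi_lie semi_lie_bilinear.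

Lemma semi_liexx x : semi_lie x x = 0.
Proof. by rewrite /semi_lie subrr. Qed.

Lemma semi_jacobi x y w :
  semi_lie x (semi_lie y w) + semi_lie y (semi_lie w x)
    + semi_lie w (semi_lie x y) = 0.
Proof.
rewrite /semi_lie /=; congr pair; first by rewrite /= !addr0.
case: x y w => [a u] [b v] [c t]; rewrite /= !scale0r !subr0 !mulmxBl -!scalemxAl.
move: (u *m A *m A) (v *m A *m A) (t *m A *m A) => u2 v2 t2.
by apply/rowP => i; rewrite !mxE; ring.
Qed.

Definition semi_lieAlgebra : lieAlgebra R := LieAlgebra semi_liexx semi_jacobi.

Definition semi_ip (x y : semi_lieAlgebra) : R := (x.1 : R) * y.1 + rdot x.2 y.2.

Lemma semi_ip_bilinear : bilinear_for *%R (idfun \; *%R) semi_ip.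
Proof.
split=> [w|w] a x y; rewrite /semi_ip /=.
  rewrite rdotPl -[(a *: x.1 + y.1)]/(a * x.1 + y.1); ring.
rewrite rdotPr -[(a *: x.1 + y.1)]/(a * x.1 + y.1); ring.
Qed.

Lemma semi_ip_sym x y : semi_ip x y = (-1) ^+ false * idfun (semi_ip y x).
Proof. by rewrite expr0 mul1r /semi_ip /= rdotC [x.1 * _]mulrC. Qed.

Lemma semi_ip_gt0 (x : semi_lieAlgebra) : x != 0 -> 0 < semi_ip x x.
Proof.
case: x => s v; rewrite /semi_ip /= -expr2.
have [-> s0|v0 _] := eqVneq v 0.
  rewrite rdot0l addr0 exprn_even_gt0 //=.
  by apply: contraNneq s0 => ->.
by rewrite ltr_wpDl ?sqr_ge0 // rdot_gt0.
Qed.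

HB.instance Definition _ := bilinear_isBilinear.Build R
  semi_lieAlgebra semi_lieAlgebra R *%R (idfun \; *%R) semi_ip semi_ip_bilinear.
HB.instance Definition _ := isHermitianSesquilinear.Build R
  semi_lieAlgebra false idfun semi_ip semi_ip_sym.
HB.instance Definition _ := isDotProduct.Build R
  semi_lieAlgebra semi_ip semi_ip_gt0.

Definition semidirect : metricLieAlgebra R :=
  @MetricLieAlgebra R semi_lieAlgebra semi_ip.

Lemma semi_ipE (x y : semidirect) : ip x y = (x.1 : R) * y.1 + rdot x.2 y.2.
Proof. by []. Qed.

Lemma semi_lieE (x y : semidirect) :
  lie x y = (0, (x.1 : R) *: (y.2 *m A) - (y.1 : R) *: (x.2 *m A)) :> V.
Proof. by []. Qed.

Lemma dim_semidirect : \dim {:semidirect} = n.+1.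
Proof. rewrite dimvf; exact: (congr1 S (mul1n n)). Qed.

(** Brackets have zero first component, so the first derived algebra lies in the abelian ideal [R^n]
    and the second one vanishes. *)
Lemma semidirect_solvable : lie_solvable semidirect.
Proof.
exists 2%N; apply/eqP; rewrite -subv0 /=.
have fstK (U : {vspace semidirect}) :
    (derived (g := semidirect) U <= lker (linfun (fst : V -> R^o)))%VS.
  by apply: sub_derived => x y _ _; rewrite memv_ker lfunE.
apply: (@sub_derived R semidirect) => x y /(subvP (fstK _)) + /(subvP (fstK _)).
rewrite !memv_ker !lfunE /= => /eqP x0 /eqP y0.
by rewrite memv0 semi_lieE x0 y0 !scale0r subrr.
Qed.

(** * Connection and Ricci curvature of the semidirect product *)

Hypothesis symA : A^T = A.

(* This is the Levi-Civita connection only for symmetric A. *)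
Definition semi_nabla x y : V :=
  (rdot (x.2 *m A) y.2, - ((y.1 : R) *: (x.2 *m A))).

Lemma semi_nabla_bilinear : bilinear_for *:%R *:%R semi_nabla.
Proof.
split=> [w|w] a x y; rewrite /semi_nabla; congr pair; rewrite /=.
- by rewrite mulmxDl -scalemxAl rdotPl.
- by rewrite mulmxDl -scalemxAl scalerDr scalerA opprD mulrC -scalerA -scalerN.
- by rewrite rdotPr.
- by rewrite scalerDl opprD scalerN scalerA.
Qed.

HB.instance Definition _ := bilinear_isBilinear.Build R
  semidirect semidirect semidirect *:%R *:%R semi_nabla semi_nabla_bilinear.

(** Symmetry of [A] cancels the first components in the torsion identity; for skewness, the two
    components of [semi_nabla] cancel against each other. *)
Lemma semi_levi_civita : levi_civita (g := semidirect) semi_nabla.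
Proof.
split=> [x y|x y w].
  rewrite semi_lieE /semi_nabla; congr pair => /=.
    by rewrite rdot_sym // rdotC subrr.
  by rewrite opprK addrC.
by rewrite !semi_ipE /= rdotNl rdotNr rdotZl rdotZr (rdotC _ _ y.2); ring.
Qed.

Definition semi_ext (B : 'M[R]_n) x : V := (0, x.2 *m B).

Lemma semi_ext_linear B : linear (semi_ext B).
Proof.
move=> a x y; rewrite /semi_ext; congr pair; rewrite /= ?scaler0 ?addr0 //.
by rewrite mulmxDl -scalemxAl.
Qed.

HB.instance Definition _ B := GRing.isLinear.Build R
  semidirect semidirect *:%R (semi_ext B) (semi_ext_linear B).

(** As [semi_ext B] kills the [R] factor, the Leibniz rule reduces to [B] commuting with the action
    [A] of [(1, 0)]. *)
Lemma semi_ext_derivation B : A *m B = B *m A ->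
  derivation (g := semidirect) (linfun (semi_ext B)).
Proof.
move=> AB x y; rewrite !lfunE /=.
rewrite !semi_lieE /semi_ext; congr pair => /=.
  by rewrite addr0.
by rewrite mulmxBl -!scalemxAl -!mulmxA AB !scale0r subr0 sub0r addrC.
Qed.

(** The sum type splits traces into the contributions of [R] and of [R^n]. *)
Definition semi_frame (i : 'I_1 + 'I_n) : semidirect :=
  match i with inl _ => (1, 0) | inr j => (0, delta_mx 0 j) end.

Lemma semi_ip_inr x j : ip (x : semidirect) (semi_frame (inr j)) = x.2 0 j.
Proof. by rewrite semi_ipE /= mulr0 add0r rdot_delta. Qed.

Lemma semi_ip_inl x i : ip (x : semidirect) (semi_frame (inl i)) = x.1.
Proof. by rewrite semi_ipE /= rdotC rdot0l mulr1 addr0. Qed.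

Lemma semi_frameK (x : semidirect) :
  x = \sum_i ip x (semi_frame i) *: semi_frame i.
Proof.
rewrite big_sumType big_ord1 semi_ip_inl.
under eq_bigr do rewrite semi_ip_inr.
have sumE (v : 'rV[R]_n) :
    \sum_j v 0 j *: (semi_frame (inr j) : V) = (0, \sum_j v 0 j *: delta_mx 0 j).
  by elim/big_rec2: _ => [//|j p q _ ->]; congr pair; rewrite /= scaler0 addr0.
rewrite sumE -row_sum_delta; case: x => s v; congr pair => /=.
  by rewrite addr0 -[_ *: _]/(s * 1) mulr1.
by rewrite scaler0 add0r.
Qed.

Lemma semi_ricci x y : ricci_form (g := semidirect) semi_nabla x y =
  - (\tr (A *m A) * (x.1 * y.1) + \tr A * rdot (x.2 *m A) y.2).
Proof.
rewrite /ricci_form.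
rewrite (endo_trace_ip _ _ _ _ _ (curvature_linear _ _ _ _ _) semi_frameK).
rewrite big_sumType big_ord1 semi_ip_inl.
under eq_bigr do rewrite semi_ip_inr.
rewrite /curvature !semi_lieE /semi_nabla /=.
rewrite !mul0mx !rdot0l !scaler0 scale1r subr0 oppr0.
rewrite (rdotC _ _ _ 0) rdot0l.
(* Contribution of [R^n], used with [a = rdot (x.2 *m A) y.2], [b = y.1], [v = x.2 *m A] and
   [w = y.2]. Its middle term cancels the contribution of [(1, 0)]. *)
have sumE (a b : R) (v w : 'rV[R]_n) :
    \sum_i (- (a *: (delta_mx 0 i *m A)) - - (rdot (delta_mx 0 i *m A) w *: v)
      - - (b *: ((0 *: v - x.1 *: (delta_mx 0 i *m A)) *m A)) : 'rV_n) 0 i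
    = - a * \tr A + rdot (v *m A) w - b * x.1 * \tr (A *m A).
  rewrite -(sum_rdot_delta_mul_mx _ _ A) -!sum_delta_mul_mx !mulr_sumr.
  rewrite -!sumrN -!big_split /=; apply: eq_bigr => i _.
  rewrite scale0r sub0r mulNmx -scalemxAl mulmxA !mxE.
  ring.
rewrite sumE; ring.
Qed.

Lemma semidirect_solvsoliton : solvsoliton semidirect.
Proof.
split; first exact: semidirect_solvable.
pose c := \tr (A *m A).
pose D := linfun (semi_ext (c%:M - \tr A *: A)) : 'End(semidirect).
exists semi_nabla, (- c *: \1%VF + D), (- c), D; split=> //.
- exact: semi_levi_civita.
- move=> x y; rewrite semi_ricci add_lfunE scale_lfunE id_lfunE lfunE /=.
  rewrite semi_ipE /=.
  have -> : x.2 *m (c%:M - \tr A *: A) = c *: x.2 - \tr A *: (x.2 *m A).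
    by rewrite mulmxBr mul_mx_scalar -scalemxAr.
  by rewrite rdotDl rdotDl rdotNl !rdotZl -[- c *: x.1]/(- c * x.1); ring.
- apply: semi_ext_derivation.
  by rewrite mulmxBr mulmxBl -scalemxAr scalemxAl scalar_mxC.
Qed.

End Semidirect.

(** * Orthonormal families *)

Section Orthonormal.
Variables (R : realType) (g : metricLieAlgebra R) (n : nat) (X : n.-tuple g).
Hypothesis onX : forall i j : 'I_n, ip X`_i X`_j = (i == j)%:R.

Lemma ip_lin_comb (k : 'I_n -> R) (i : 'I_n) : ip (\sum_j k j *: X`_j) X`_i = k i.
Proof.
have ipZ (j : 'I_n) : ip (k j *: X`_j) X`_i = k j * (j == i)%:R.
  by rewrite -onX; exact: linearZl_LR.
rewrite linear_sumlz (bigD1 i) //= ipZ eqxx mulr1 big1 ?addr0 // => j /negPf ji.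
by rewrite ipZ ji mulr0.
Qed.

(** Pairing a vanishing combination with each [X_i] gives freeness; the dimension count gives
    spanning. *)
Lemma basis_of_orthonormal : \dim {:g} = n -> basis_of fullv X.
Proof.
move=> dim_g; rewrite basisEfree dim_g size_tuple leqnn subvf !andbT.
apply/freeP => k sum0 i; rewrite -(ip_lin_comb k) sum0.
exact: linear0l.
Qed.

End Orthonormal.

Lemma dim_line_product (R : realType) (h : metricLieAlgebra R) :
  \dim {:line_product h} = (\dim {:h}).+1.
Proof. by rewrite !dimvf. Qed.

Lemma lie_anti (R : realType) (g : lieAlgebra R) (x y : g) : lie x y = - lie y x.
Proof.
have := liexx (x + y); rewrite linearDl !linearDr !liexx add0r addr0.
by move/eqP; rewrite addr_eq0 => /eqP.
Qed.

(** * Structure constants of the distinguished frames *)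

Section GmFrame.
Variables (R : realType) (alpha beta : R).

(** The coefficients are chosen before [z], [g] and [X], so that one choice serves every [g_m] and,
    at [z = 0], the limit. *)
Lemma gm_lie_affine (i j : 'I_4) : exists p q r s : R,
  forall z (g : metricLieAlgebra R) (X : 4.-tuple g), gm_frame alpha beta z X ->
  lie X`_i X`_j = (p + q * z) *: X`_2 + (r + s * z) *: X`_3.
Proof.
wlog ij : i j / (i <= j)%N => [IH|].
  have [/IH//|/ltnW /IH[p [q [r [s lieE]]]]] := leqP i j.
  exists (- p), (- q), (- r), (- s) => z g X frX.
  by rewrite lie_anti (lieE z) // opprD -!scaleNr !opprD !mulNr.
have lie0_affine :
    (forall z (g : metricLieAlgebra R) (X : 4.-tuple g),
      gm_frame alpha beta z X -> lie X`_i X`_j = 0) ->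
  exists p q r s : R, forall z (g : metricLieAlgebra R) (X : 4.-tuple g),
    gm_frame alpha beta z X ->
    lie X`_i X`_j = (p + q * z) *: X`_2 + (r + s * z) *: X`_3.
  move=> lie0; exists 0, 0, 0, 0 => z g X /lie0 ->.
  by rewrite mul0r addr0 !scale0r addr0.
(* Equal indices and the pairs (0,1) and (2,3) give zero brackets. There remain (0,2), (0,3), (1,2)
   and (1,3), in this order. *)
move: ij lie0_affine; case: i j => [[|[|[|[|//]]]] ?] [[|[|[|[|//]]]] ?] //= _ lie0;
  try by apply: lie0 => z g X [_ [? ? _ _ _]]; rewrite ?liexx.
- exists 0, (- (2 - 3 * alpha + alpha ^+ 2 + beta ^+ 2)), 0, beta => z g X.
  by case=> _ [_ _ _ -> _]; rewrite !add0r.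
- exists 0, beta, 0, (- (- alpha + alpha ^+ 2 + beta ^+ 2)) => z g X.
  by case=> _ [_ _ _ _ ->]; rewrite !add0r.
- exists alpha, 0, beta, 0 => z g X.
  by case=> _ [_ _ [-> _] _ _]; rewrite !mul0r !addr0.
- exists beta, 0, (2 - alpha), 0 => z g X.
  by case=> _ [_ _ [_ ->] _ _]; rewrite !mul0r !addr0.
Qed.

Lemma gm_struct_const_affine (i j k : 'I_4) : exists a b : R,
  forall z (g : metricLieAlgebra R) (X : 4.-tuple g), gm_frame alpha beta z X ->
  struct_const X i j k = a + b * z.
Proof.
have [p [q [r [s lieE]]]] := gm_lie_affine i j.
pose d2 : R := (inord 2 == k)%:R; pose d3 : R := (inord 3 == k)%:R.
exists (p * d2 + r * d3), (q * d2 + s * d3) => z g X frX.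
have [[_ onX] _] := frX.
rewrite /struct_const (lieE z) //.
have := onX (inord 2) k; have := onX (inord 3) k; rewrite !inordK // => X3 X2.
transitivity ((p + q * z) * ip X`_2 X`_k + (r + s * z) * ip X`_3 X`_k).
  rewrite [LHS]linearPl; congr (_ + _); exact: linearZl_LR.
by rewrite X2 X3 -/d2 -/d3; ring.
Qed.

Definition limit_mx : 'M[R]_2 :=
  \matrix_(i, j) (if i == j then if i == 0 then alpha else 2 - alpha else beta).

Lemma limit_mx_sym : limit_mx^T = limit_mx.
Proof. by apply/matrixP => i j; rewrite !mxE eq_sym; case: eqP => // ->. Qed.

Definition limit_frame : 4.-tuple (line_product (semidirect R 2 limit_mx)) :=
  [tuple (1, 0); (0, (1, 0)); (0, (0, delta_mx 0 0)); (0, (0, delta_mx 0 1))].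

(** Makes the limit the [z = 0] member of the family, so that [gm_struct_const_affine] applies to it
    as well. *)
Lemma limit_frame_gm : gm_frame alpha beta 0 limit_frame.
Proof.
split.
  have onY (i j : 'I_4) : ip limit_frame`_i limit_frame`_j = (i == j)%:R.
    have ipE (u v : line_product (semidirect R 2 limit_mx)) :
      ip u v = u.1 * v.1 + ip u.2 v.2 :> R by [].
    case: i j => [[|[|[|[|//]]]] ?] [[|[|[|[|//]]]] ?];
      rewrite ipE semi_ipE /= ?rdot0l ?rdot_delta ?mxE ?(rdotC _ _ _ 0) ?rdot0l
        ?mxE /=; ring.
  split=> //; apply: basis_of_orthonormal => //.
  by rewrite dim_line_product dim_semidirect.
rewrite /limit_frame /= !mulr0 !scale0r !addr0.
split; [| |split| |].
(* Vectors are compared on the line factor first, then on the two components of the semidirect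
   product. *)
all: apply: injective_projections; rewrite ?[RHS]/= ?scaler0 ?addr0 //.
all: apply: injective_projections; rewrite [LHS]/= ?[RHS]/= ?scaler0 ?addr0 //.
all: rewrite ?mul0mx ?scaler0 ?scale0r ?subr0 ?scale1r -?rowE //.
all: apply/rowP => -[[|[|//]] ?]; rewrite !mxE /=; ring.
Qed.

End GmFrame.

(** * Passage to the limit *)

Lemma cvg_gm_parameter (R : realType) (alpha beta : R) (z : R -> R) :
    (forall m : R, 0 < m ->
       z m ^+ 2 = - 4 / (einstein_const alpha beta * (m + 2) + 4)) ->
  z m @[m --> +oo] --> 0.
Proof.
move=> hz; apply/cvgr0Pnorm_lt => /= e e0; near=> m.
have m0 : 0 < m by near: m; exact/nbhs_pinfty_gt/num_real.
(* This threshold turns the bound [2 / m] on [z m ^+ 2] into [e ^+ 2]. *)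
have me : 2 / e ^+ 2 < m by near: m; exact/nbhs_pinfty_gt/num_real.
rewrite -ltr_sqr ?nnegrE ?normr_ge0 ?ltW // real_normK ?num_real // hz //.
set l := einstein_const alpha beta.
(* Completing the square, [l = - 2 * ((alpha - 1) ^+ 2 + beta ^+ 2 + 1)]. *)
have l2 : l <= - 2.
  have := sqr_ge0 (alpha - 1); have := sqr_ge0 beta.
  by rewrite /l /einstein_const; lra.
have lm : l * (m + 2) + 4 <= - (2 * m) by nra.
(* Both signs are flipped to make the denominator positive before clearing it. *)
rewrite -mulrNN -invrN opprK ltr_pdivrMr; last by lra.
move: me; rewrite ltr_pdivrMr ?exprn_gt0 // => me.
have := exprn_gt0 2 e0.
nra.
Unshelve. all: by end_near.
Qed.

Theorem theorem6p10 (R : realType) (alpha beta : R)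
    (hbeta : beta != 0)
    (halpha : (alpha - 1) ^+ 2 + beta ^+ 2 != 1)
    (z : R -> R)
    (hz : forall m : R, 0 < m ->
       z m < 0 /\ z m ^+ 2 = - 4 / (einstein_const alpha beta * (m + 2) + 4))
    (G : R -> metricLieAlgebra R) (X : forall m : R, 4.-tuple (G m))
    (hX : forall m : R, 0 < m -> gm_frame alpha beta (z m) (X m)) :
  exists H : metricLieAlgebra R,
    [/\ \dim {:H} = 3%N, solvsoliton H & smooth_cvg X (line_product H)].
Proof.
exists (semidirect R 2 (limit_mx R alpha beta)); split.
- exact: dim_semidirect.
- exact/semidirect_solvsoliton/limit_mx_sym.
exists (limit_frame R alpha beta).
have frY := limit_frame_gm R alpha beta.
split=> [|i j k]; first by case: frY.
have [a [b structE]] := gm_struct_const_affine R alpha beta i j k.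
(* The target is the same affine function evaluated at [z = 0]. *)
rewrite (structE 0) //.
have cvg_ab : a + b * z m @[m --> +oo] --> a + b * 0.
  apply: cvgD; first exact: cvg_cst.
  apply: cvgM; first exact: cvg_cst.
  by apply: (cvg_gm_parameter R alpha beta) => m /hz[].
(* The frames are prescribed for [0 < m], so the affine formula is available eventually, which is
   enough at infinity. *)
apply: cvg_trans cvg_ab; apply: near_eq_cvg; near=> m.
rewrite (structE (z m)) //; apply: hX.
by near: m; exact/nbhs_pinfty_gt/num_real.
Unshelve. all: by end_near.
Qed.
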